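(* Let $E$ be a (directed) graph, let $G(E)$ be the graph inverse semigroup of $E$, and let $L(G(E))$ be the lattice of congruences of $G(E)$. Then every congruence in $L(G(E))$ is the join of a (possibly infinite) collection of atoms if and only if for every $v\in E^0$ one of the following holds: (i) $|\mathbf{s}^{-1}(v)|=0$; (ii) $|\mathbf{s}^{-1}(v)|=1$, $v$ does not belong to a cycle, and $v>u$ for some $u\in E^0$ such that $|\mathbf{s}^{-1}(u)|\ne1$; (iii) $|\mathbf{s}^{-1}(v)|\ge2$, and $\mathbf{r}(e)\ge v$ for all $e\in\mathbf{s}^{-1}(v)$. Moreover, $L(G(E))$ is atomistic if and only if every $v\in E^0$ satisfies one of (i), (ii), (iii) and, in addition, $E^0$ has only finitely many strongly connected components and only finitely many vertices $v$ such that $|\mathbf{s}^{-1}(v)|=1$.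
   Context: A (directed) graph $E=(E^0,E^1,\mathbf{s},\mathbf{r})$ consists of a set $E^0$ of vertices, a set $E^1$ of edges (both arbitrary, possibly infinite), and functions $\mathbf{s},\mathbf{r}:E^1\to E^0$ (source and range). A path is a finite sequence $p=e_1\cdots e_n$ of edges with $\mathbf{r}(e_i)=\mathbf{s}(e_{i+1})$ for $1\le i\le n-1$; $\mathbf{s}(p)=\mathbf{s}(e_1)$, $\mathbf{r}(p)=\mathbf{r}(e_n)$; vertices are paths of length $0$. A cycle is a path $e_1\cdots e_n$ with $n\ge1$, equal source and range, and $\mathbf{s}(e_i)\ne\mathbf{s}(e_j)$ for $i\ne j$; a vertex belongs to it if it equals some $\mathbf{s}(e_i)$. For $u,v\in E^0$ write $u\ge v$ if there is a path (possibly of length $0$) from $u$ to $v$, and $u>v$ if $u\ge v$ and $u\ne v$. A strongly connected component is a non-empty set $H\subseteq E^0$ such that $u\ge v$ for all $u,v\in H$ and $H$ is maximal with this property. The graph inverse semigroup $G(E)$ is the semigroup with zero generated by $E^0\cup E^1\cup\{e^{-1}\mid e\in E^1\}$ subject to, for all $u,v\in E^0$ and $e,f\in E^1$: $vu=\delta_{v,u}v$; $\mathbf{s}(e)e=e\mathbf{r}(e)=e$; $\mathbf{r}(e)e^{-1}=e^{-1}\mathbf{s}(e)=e^{-1}$; $e^{-1}f=\delta_{e,f}\mathbf{r}(e)$ (here $\delta$ is the Kronecker delta, so $\delta_{x,y}z$ means $z$ if $x=y$ and the zero element otherwise). A congruence on a semigroup $S$ is an equivalence relation $\rho$ on $S$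 such that $(x,y)\in\rho$ implies $(zx,zy),(xz,yz)\in\rho$ for all $z\in S$. $L(S)$ is the (complete) lattice of all congruences on $S$ ordered by containment; its least element is the diagonal congruence, which by convention is the join of the empty set. In a lattice with least element $0$, an atom is an element $a>0$ such that there is no $c$ with $0<c<a$. A lattice is atomistic if every element is a join of finitely many (possibly zero) atoms. *)

(* Defs.v *)
From HB Require Import structures.
From mathcomp Require Import all_boot all_order.
From mathcomp Require Import generic_quotient.
From mathcomp Require Import boolp classical_sets functions cardinality.

Set Implicit Arguments.
Unset Strict Implicit.
Unset Printing Implicit Defensive.

Import Order.TTheory.

Local Open Scope classical_set_scope.
Local Open Scope quotient_scope.

(* The least equivalence relation containing R and compatible with op. *)
Inductive cong_closure (T : Type) (op : T -> T -> T) (R : T -> T -> Prop) :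
    T -> T -> Prop :=
  | Cgen x y of R x y : cong_closure op R x y
  | Crefl x : cong_closure op R x x
  | Csym x y of cong_closure op R x y : cong_closure op R y x
  | Ctrans x y z of cong_closure op R x y & cong_closure op R y z :
      cong_closure op R x z
  | Cmull z x y of cong_closure op R x y : cong_closure op R (op z x) (op z y)
  | Cmulr z x y of cong_closure op R x y : cong_closure op R (op x z) (op y z).

Section Congruences.
Local Open Scope group_scope.

Definition is_congruence (S : semigroupType) (rho : S -> S -> Prop) : Prop :=
  [/\ forall x, rho x x,
      forall x y, rho x y -> rho y x,
      forall x y z, rho x y -> rho y z -> rho x z
    & forall x y, rho x y -> forall z, rho (z * x) (z * y) /\ rho (x * z) (y * z)].

End Congruences.

Record congruence (S : semigroupType) := Congruence {
  cong_rel :> S -> S -> Prop;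
  congP : is_congruence cong_rel
}.

HB.instance Definition _ (S : semigroupType) := gen_eqMixin (congruence S).
HB.instance Definition _ (S : semigroupType) := gen_choiceMixin (congruence S).

Fact cong_display : Order.disp_t. Proof. exact: Order.Disp tt tt. Qed.

Section CongruenceLattice.
Variable S : semigroupType.
Implicit Types (rho sigma tau : congruence S) (A : set (congruence S)).

Lemma cong_inj rho sigma : (forall x y, rho x y <-> sigma x y) -> rho = sigma.
Proof.
case: rho sigma => [r rP] [s sP] /= rs.
have rsE : r = s by apply/funext => x; apply/funext => y; apply/propext.
by case: s / rsE sP {rs} => sP; congr Congruence; apply: Prop_irrelevance.
Qed.

Definition cong_le rho sigma : bool := `[< forall x y, rho x y -> sigma x y >].

Fact cong_le_refl : reflexive cong_le.
Proof. by move=> rho; apply/asboolP. Qed.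

Fact cong_le_anti : antisymmetric cong_le.
Proof.
move=> rho sigma /andP[/asboolP rs /asboolP sr].
by apply: cong_inj => x y; split; [exact: rs | exact: sr].
Qed.

Fact cong_le_trans : transitive cong_le.
Proof.
move=> sigma rho tau /asboolP rs /asboolP st.
by apply/asboolP => x y /rs /st.
Qed.

HB.instance Definition _ := Order.Le_isPOrder.Build cong_display (congruence S)
  cong_le_refl cong_le_anti cong_le_trans.

Lemma cong_leP rho sigma :
  reflect (forall x y, rho x y -> sigma x y) (rho <= sigma)%O.
Proof. exact: asboolP. Qed.

Fact cong_diag_subproof : is_congruence (fun x y : S => x = y).
Proof. by split=> // [x y z -> -> | x y ->]. Qed.

Definition cong_diag : congruence S := Congruence cong_diag_subproof.

Fact cong_diag_le rho : (cong_diag <= rho)%O.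
Proof. by apply/cong_leP => x _ <-; case: (congP rho). Qed.

HB.instance Definition _ := Order.hasBottom.Build cong_display (congruence S)
  cong_diag_le.

Fact cong_meet_subproof rho sigma :
  is_congruence (fun x y => rho x y /\ sigma x y).
Proof.
case: (congP rho) (congP sigma) => [r1 r2 r3 r4] [s1 s2 s3 s4].
split=> [x | x y [/r2 ? /s2 ?] | x y z [rxy sxy] [ryz syz] | x y [rxy sxy] z].
- by split.
- by split.
- by split; [exact: r3 ryz | exact: s3 syz].
- by have [? ?] := r4 _ _ rxy z; have [? ?] := s4 _ _ sxy z.
Qed.

Definition cong_meet rho sigma := Congruence (cong_meet_subproof rho sigma).

Fact cong_sup_subproof A :
  is_congruence (cong_closure (@mul S) (fun x y => exists2 rho, A rho & rho x y)).
Proof.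
split=> [x | x y | x y z | x y xy z].
- exact: Crefl.
- exact: Csym.
- exact: Ctrans.
- by split; [exact: Cmull | exact: Cmulr].
Qed.

Definition cong_sup A : congruence S := Congruence (cong_sup_subproof A).

Lemma cong_sup_supremums A : supremums A (cong_sup A).
Proof.
split=> [rho Arho | sigma ub].
  by apply/cong_leP => x y xy; apply: Cgen; exists rho.
apply/cong_leP => x y /=; case: (congP sigma) => [s1 s2 s3 s4].
elim=> {x y} [x y [rho Arho xy]|x|x y _ xy|x y z _ xy _ yz|z x y _ xy|z x y _ xy].
- exact: (elimT (cong_leP _ _) (ub _ Arho)).
- exact: s1.
- exact: s2.
- exact: s3 yz.
- by have [] := s4 _ _ xy z.
- by have [] := s4 _ _ xy z.
Qed.

Fact cong_meetP tau rho sigma :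
  (tau <= cong_meet rho sigma)%O = (tau <= rho)%O && (tau <= sigma)%O.
Proof.
apply/cong_leP/andP => [trs | [/cong_leP tr /cong_leP ts] x y xy].
  by split; apply/cong_leP => x y /trs [].
by split; [exact: tr | exact: ts].
Qed.

Definition cong_join rho sigma := cong_sup [set rho; sigma].

Fact cong_joinP rho sigma tau :
  (cong_join rho sigma <= tau)%O = (rho <= tau)%O && (sigma <= tau)%O.
Proof.
have [ub lub] := cong_sup_supremums [set rho; sigma].
apply/idP/andP => [le | [rt st]].
  by split; apply: le_trans le; apply: ub; [left | right].
by apply: lub => _ [] ->.
Qed.

HB.instance Definition _ := Order.POrder_MeetJoin_isLattice.Build
  cong_display (congruence S) cong_meetP cong_joinP.

End CongruenceLattice.

Section Atoms.
Local Open Scope order_scope.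

Definition atom d (L : bLatticeType d) (a : L) : Prop :=
  \bot < a /\ ~ (exists c : L, \bot < c < a).

Definition atomistic d (L : bLatticeType d) : Prop :=
  forall x : L, exists2 s : seq L,
    {in s, forall a, atom a} & x = \join_(a <- s) a.

End Atoms.

Record digraph := Digraph {
  vertex : Type;
  edge : Type;
  src : edge -> vertex;
  rng : edge -> vertex
}.

Section DigraphTheory.
Variable E : digraph.
Implicit Types (u v : vertex E) (e : edge E) (p : seq (edge E)).

(* edge_path u p v: the word p is a path from u to v; when p is empty, this is
   the path of length 0 at u = v. *)
Fixpoint edge_path u p v : Prop :=
  if p is e :: p' then src e = u /\ edge_path (rng e) p' v else u = v.

Definition is_cycle p : Prop :=
  [/\ p <> [::],
      exists v, edge_path v p v
    & forall i j : 'I_(size p), i <> j ->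
        src (tnth (in_tuple p) i) <> src (tnth (in_tuple p) j)].

Definition in_cycle v : Prop :=
  exists2 p, is_cycle p & exists i : 'I_(size p), v = src (tnth (in_tuple p) i).

Definition vge u v : Prop := exists p, edge_path u p v.

Definition vgt u v : Prop := vge u v /\ u <> v.

Definition mutually_reachable (H : set (vertex E)) : Prop :=
  forall u v, H u -> H v -> vge u v.

Definition strong_component (H : set (vertex E)) : Prop :=
  [/\ H !=set0, mutually_reachable H
    & forall K, mutually_reachable K -> H `<=` K -> K = H].

Definition out_edges v : set (edge E) := [set e | src e = v].

End DigraphTheory.

Section GraphInverseSemigroup.
Variable E : digraph.

(* Formal products of the generators and of the zero symbol. *)
Inductive gis_term : Type :=
  | GZero
  | GVertex of vertex E
  | GEdge of edge E
  | GInv of edge E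
  | GMul of gis_term & gis_term.

(* The first three constructors are the axioms of semigroups with zero. *)
Inductive gis_rel : gis_term -> gis_term -> Prop :=
  | gis_mulA x y z : gis_rel (GMul x (GMul y z)) (GMul (GMul x y) z)
  | gis_mul0 x : gis_rel (GMul GZero x) GZero
  | gis_mulx0 x : gis_rel (GMul x GZero) GZero
  | gis_vv v : gis_rel (GMul (GVertex v) (GVertex v)) (GVertex v)
  | gis_vu v u of v <> u : gis_rel (GMul (GVertex v) (GVertex u)) GZero
  | gis_se e : gis_rel (GMul (GVertex (src e)) (GEdge e)) (GEdge e)
  | gis_er e : gis_rel (GMul (GEdge e) (GVertex (rng e))) (GEdge e)
  | gis_rV e : gis_rel (GMul (GVertex (rng e)) (GInv e)) (GInv e)
  | gis_Vs e : gis_rel (GMul (GInv e) (GVertex (src e))) (GInv e)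
  | gis_Ve e : gis_rel (GMul (GInv e) (GEdge e)) (GVertex (rng e))
  | gis_Vf e f of e <> f : gis_rel (GMul (GInv e) (GEdge f)) GZero.

HB.instance Definition _ := gen_eqMixin gis_term.
HB.instance Definition _ := gen_choiceMixin gis_term.

Definition gis_eqv : rel gis_term :=
  fun x y => `[< cong_closure GMul gis_rel x y >].

Fact gis_eqv_class : equiv_class_of gis_eqv.
Proof.
split=> [x | x y | y x z].
- by apply/asboolP; exact: Crefl.
- by apply/asboolP/asboolP; exact: Csym.
- by move=> /asboolP xy /asboolP yz; apply/asboolP; exact: Ctrans yz.
Qed.

Canonical gis_equiv := EquivRelPack gis_eqv_class.

Definition gis : Type := {eq_quot gis_equiv}.

HB.instance Definition _ := Choice.on gis.
HB.instance Definition _ := EqQuotient.on gis.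

Lemma gis_piP (x y : gis_term) :
  \pi_gis x = \pi_gis y <-> cong_closure GMul gis_rel x y.
Proof. by split=> [/eqmodP/asboolP | xy]; last exact/eqmodP/asboolP. Qed.

Definition gis_mul (x y : gis) : gis := \pi_gis (GMul (repr x) (repr y)).

Lemma gis_mul_pi (x y : gis_term) :
  gis_mul (\pi_gis x) (\pi_gis y) = \pi_gis (GMul x y).
Proof.
apply/gis_piP; apply: (@Ctrans _ _ _ _ (GMul x (repr (\pi_gis y)))).
  by apply: Cmulr; apply/gis_piP; rewrite reprK.
by apply: Cmull; apply/gis_piP; rewrite reprK.
Qed.

Fact gis_mul_assoc : associative gis_mul.
Proof.
elim/quotW=> x; elim/quotW=> y; elim/quotW=> z.
rewrite (gis_mul_pi y z) (gis_mul_pi x (GMul y z)) (gis_mul_pi x y).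
rewrite (gis_mul_pi (GMul x y) z).
by apply/gis_piP; apply: Cgen; exact: gis_mulA.
Qed.

HB.instance Definition _ := isSemigroup.Build gis gis_mul_assoc.

End GraphInverseSemigroup.

(* Main.v *)
Require Import Defs.
From HB Require Import structures.
From mathcomp Require Import all_boot all_order.
From mathcomp Require Import generic_quotient.
From mathcomp Require Import boolp classical_sets functions cardinality.

(** Every nonzero element of G(E) is a product p q^-1 of a path and an inverse
    path, and G(E) acts by partial injections on the paths of E ending at a
    given vertex, which separates the elements that have to be told apart. Say
    that a congruence kills v if it relates v to zero; it then kills
    everything below v.

    Cancelling outer factors in a related pair p q^-1, r s^-1 leaves a vertex
    related to zero, to an idempotent t t^-1, or to a closed path. If all
    vertices satisfy (i), (ii) or (iii), a vertex that is not killed is never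
    related to a nontrivial closed path, and t t^-1 splits into one step for
    each edge of t. So a congruence is determined by the vertices v that it
    kills and by the edges e from v for which it relates v to e e^-1
    (good_cong_le). Relating v to e e^-1 kills the ranges of the other edges
    at v; in case (iii) these lead back to v, so only vertices with a sole
    edge contribute pairs of the second kind without being killed.

    Hence every vertex v has one atom attached to it. If v has a sole edge e,
    it is the congruence generated by (v, e e^-1), which is the kernel of the
    action on paths not ending at v. Otherwise it is the Rees congruence of
    the ideal of v, which depends only on the strongly connected component of
    v. Every congruence is the join of the attached atoms below it: a killed
    vertex with a sole edge e is related to e e^-1, and the unique path from
    it leads to a killed vertex of the other sort (canonical_atoms_supremum).

    Conversely, let every congruence be a join of atoms. Joins are transitive
    closures of unions, so an element that a congruence moves, that is,
    relates to another element, is moved by an atom below it. An atom that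
    kills v is the Rees congruence of every vertex below v, so all these
    vertices lead back to v; and v has no sole edge e, since relating v to e
    e^-1 is possible without killing anything. Looking for the atoms that move
    zero, or v, in the Rees congruence of v gives the three conditions
    (joins_good_vertex).

    For finite joins: the universal congruence moves every vertex, so all the
    attached atoms occur in any expression of it as a join of atoms, and there
    are finitely many of them exactly when there are finitely many components
    and finitely many vertices with a sole edge. *)

Local Open Scope classical_set_scope.
Local Open Scope card_scope.

Section Congruences.

Set Implicit Arguments.
Unset Strict Implicit.
Unset Printing Implicit Defensive.

Local Open Scope group_scope.

Import Order.TTheory.

Variable T : semigroupType.
Implicit Types (a b x y : T) (rho sigma alpha : congruence T).
Implicit Types (A : set (congruence T)).

(** * Congruences of a semigroup *)

Lemma congR rho x : rho x x. Proof. by case: (congP rho). Qed.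

Lemma congS rho x y : rho x y -> rho y x.
Proof. by case: (congP rho) => _ + _ _; apply. Qed.

Lemma congT rho y x a : rho x y -> rho y a -> rho x a.
Proof. by case: (congP rho) => _ _ + _; apply. Qed.

Lemma congMl rho a x y : rho x y -> rho (a * x) (a * y).
Proof. by case: (congP rho) => _ _ _ h /h/(_ a)[]. Qed.

Lemma congMr rho a x y : rho x y -> rho (x * a) (y * a).
Proof. by case: (congP rho) => _ _ _ h /h/(_ a)[]. Qed.

Definition nontrivial rho := exists x y, rho x y /\ x <> y.

Lemma bot_lt_nontrivial rho : (\bot < rho)%O <-> nontrivial rho.
Proof.
rewrite lt_neqAle le0x andbT.
split=> [/eqP r0|[x [y [xy nxy]]]]; last first.
  by apply/eqP => r0; rewrite -r0 in xy.
apply: contrapT => rtriv; apply: r0; apply: cong_inj => x y; split=> [->|xy].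
  exact: congR.
by apply: contrapT => nxy; apply: rtriv; exists x, y.
Qed.

Lemma atomP alpha : atom alpha <-> nontrivial alpha /\
  forall c : congruence T, (c <= alpha)%O -> nontrivial c -> (alpha <= c)%O.
Proof.
rewrite /atom bot_lt_nontrivial; split=> -[nt min]; split=> //.
  move=> c ca /bot_lt_nontrivial c0; apply: contrapT => nac; apply: min.
  exists c; rewrite c0 /= lt_leAnge ca /=.
  exact/negP.
move=> [c /andP[/bot_lt_nontrivial c0]].
rewrite lt_leAnge => /andP[ca /negP[]].
exact: min.
Qed.

(** A join of congruences is the transitive closure of their union, so a point
    related to another one by the join is already related to another one by a
    member. The join lies below the congruence J of the pairs that no predicate
    invariant under all members separates. *)
Lemma sup_class_nontrivial A rho x y : supremums A rho -> rho x y -> y <> x ->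
  exists2 alpha, A alpha & exists2 y', alpha x y' & y' <> x.
Proof.
move=> [_ lub] xy yx; apply: contrapT => nA.
pose closed (P : T -> Prop) :=
  forall alpha, A alpha -> forall c d, alpha c d -> P c -> P d.
pose J c d := forall P, closed P -> (P c <-> P d).
have Jcong : is_congruence J.
  split=> [c P _|c d cd P cP|c d e cd de P cP|c d cd a] //.
  - by rewrite (cd P cP).
  - by rewrite (cd P cP) (de P cP).
  split=> P cP.
    apply: (cd (fun t => P (a * t))) => alpha Aa t t' tt'.
    by apply: cP Aa _ _ _; apply: congMl.
  apply: (cd (fun t => P (t * a))) => alpha Aa t t' tt'.
  by apply: cP Aa _ _ _; apply: congMr.
have rhoJ : (rho <= Congruence Jcong)%O.
  apply: lub => alpha Aa; apply/cong_leP => c d cd P cP.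
  by split; apply: cP Aa _ _ _ => //; apply: congS.
have xclosed : closed (fun t => t = x).
  move=> alpha Aa c d cd cx; apply: contrapT => dx; apply: nA.
  by exists alpha => //; exists d => //; rewrite -cx.
have [h _] := elimT (cong_leP _ _) rhoJ _ _ xy _ xclosed.
by apply: yx; apply: h.
Qed.

End Congruences.

Section GraphInverseSemigroupCongruences.

Set Implicit Arguments.
Unset Strict Implicit.
Unset Printing Implicit Defensive.

Local Open Scope quotient_scope.
Local Open Scope group_scope.

Import Order.TTheory.

Variable E : digraph.
Implicit Types (u v w z : vertex E) (e f g : edge E) (p q r s t : seq (edge E)).
Local Notation S := (gis E).
Implicit Types (a b x y : S) (rho sigma alpha : congruence S).

(** * Paths *)

Lemma edge_path_cat u p v q w :
  edge_path u p v -> edge_path v q w -> edge_path u (p ++ q) w.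
Proof.
elim: p u => [|e p IHp] u /=; first by move->.
by move=> [<- ep] vq; split; last exact: IHp.
Qed.

Lemma edge_path_catP u p q w :
  edge_path u (p ++ q) w -> exists2 v, edge_path u p v & edge_path v q w.
Proof.
elim: p u => [|e p IHp] u /=; first by exists u.
by case=> eu /IHp[v pv vw]; exists v.
Qed.

Lemma vge_refl v : vge v v. Proof. by exists [::]. Qed.

Lemma vge_trans v u w : vge u v -> vge v w -> vge u w.
Proof.
by move=> [p up] [q vq]; exists (p ++ q); apply: edge_path_cat up vq.
Qed.

Lemma vge_edge e : vge (src e) (rng e).
Proof. by exists [:: e]. Qed.

(** Cutting a closed path at a repeated source leaves a shorter closed path with
    the same base, so a shortest one is a cycle. *)
Lemma closed_path_in_cycle v p : edge_path v p v -> p <> [::] -> in_cycle v.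
Proof.
have [n] := ubnP (size p); elim: n p => // n IHn p; rewrite ltnS => pn vpv p0.
have [pc|/existsNP[i /existsNP[j /not_implyP[ij /contrapT sij]]]] := pselect
    (forall i j : 'I_(size p), i <> j ->
       src (tnth (in_tuple p) i) <> src (tnth (in_tuple p) j)).
  exists p; first by split=> //; exists v.
  case: p vpv p0 {pn pc IHn} => // e p [ev _] _.
  by exists ord0; rewrite (tnth_nth e) /= ev.
wlog lt_ij : i j ij sij / (i < j)%N => [th|].
  have [|ji|/ord_inj//] := ltngtP i j; first exact: th.
  by apply: (th j i) => // ji'; apply: ij.
have e0 : edge E by case: (p) (i) => [[]//|e _ _]; exact: e.
rewrite !(tnth_nth e0) /= in sij.
have srcP k : (k < size p)%N ->
    [/\ edge_path v (take k p) (src (nth e0 p k))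
      & edge_path (src (nth e0 p k)) (drop k p) v].
  move=> kp; move: vpv; rewrite -{1}(cat_take_drop k p) => /edge_path_catP[w].
  by rewrite (drop_nth e0 kp) /= => ? [-> ?].
have [iv _] := srcP i (ltn_ord i); have [_ jv] := srcP j (ltn_ord j).
rewrite -sij in jv.
apply: (IHn (take i p ++ drop j p)) => [|| /(congr1 size)].
- apply: leq_trans pn; rewrite size_cat size_drop size_takel; last exact: ltnW.
  by rewrite -[ltnRHS](subnKC (ltnW (ltn_ord j))) ltn_add2r.
- exact: edge_path_cat iv jv.
rewrite size_cat size_drop => /eqP; rewrite addn_eq0 subn_eq0 => /andP[_].
by rewrite leqNgt ltn_ord.
Qed.

Lemma in_cycle_closed_path v :
  in_cycle v -> exists2 e, src e = v & vge (rng e) v.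
Proof.
move=> [p [_ [w wpw] _] [i]]; have e0 : edge E.
  by case: (p) (i) => [[]//|e _ _]; exact: e.
rewrite (tnth_nth e0) /= => ->; exists (nth e0 p i) => //.
move: wpw; rewrite -{1}(cat_take_drop i p) (drop_nth e0) // => /edge_path_catP.
case=> u wu /= [iu iw]; exists (drop i.+1 p ++ take i p).
by rewrite iu; apply: edge_path_cat iw wu.
Qed.

Definition sink v := forall e, src e <> v.
Definition sole_edge v e := src e = v /\ forall f, src f = v -> f = e.
Definition branching v := exists e f, [/\ src e = v, src f = v & e <> f].

Lemma degree_cases v : [\/ sink v, exists e, sole_edge v e | branching v].
Proof.
have [[e ev]|no_e] := pselect (exists e, src e = v); last first.
  by constructor 1 => e ev; apply: no_e; exists e.
have [?|/existsNP[f /not_implyP[fv fe]]] :=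
  pselect (forall f, src f = v -> f = e); first by constructor 2; exists e.
by constructor 3; exists e, f; split=> // ef; apply: fe.
Qed.

Lemma out_edges_card0 v : (out_edges v #= `I_0) <-> sink v.
Proof.
rewrite II0 card_eq0; split=> [/eqP v0 e ev | sv].
  by have : out_edges v e by []; rewrite v0.
by apply/eqP/seteqP; split=> e // /sv.
Qed.

Lemma out_edges_card1 v : (out_edges v #= `I_1) <-> exists e, sole_edge v e.
Proof.
split=> [/card_set_bijP[h [hI hinj hsurj]]|[e [ev ve]]].
  have [e ev _] := hsurj 0%N isT; exists e; split=> // f fv.
  apply: hinj; rewrite ?inE //; move: (hI _ fv) (hI _ ev) => /=.
  by case: (h f) => //; case: (h e).
have -> : out_edges v = [set e].
  by apply/seteqP; split=> f /=; [exact: ve | move->].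
exact: card_set1.
Qed.

Lemma out_edges_card2 v : (`I_2 #<= out_edges v) <-> branching v.
Proof.
split=> [v2|[e [f [ev fv ef]]]].
  have [/out_edges_card0 v0|/out_edges_card1 v1|//] := degree_cases v.
    by move: v2; rewrite (card_le_eqr v0) card_le_II.
  by move: v2; rewrite (card_le_eqr v1) card_le_II.
have /injfunPex[h] : exists2 h, set_fun `I_2 (out_edges v) h & set_inj `I_2 h.
  exists (fun n => if n is 0%N then e else f); first by move=> [|[]].
  move=> [|[|?]] [|[|?]] //; rewrite !inE //= => _ _ fe;
    by case: ef; rewrite fe.
exact: inj_card_le.
Qed.

(** * Normal forms *)

Definition gzero : S := \pi_(gis E) (GZero E).
Definition gvertex v : S := \pi_(gis E) (GVertex v).
Definition gedge e : S := \pi_(gis E) (GEdge e).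
Definition ginv e : S := \pi_(gis E) (GInv e).

Lemma pi_mul (m n : gis_term E) :
  \pi_(gis E) (GMul m n) = \pi_(gis E) m * \pi_(gis E) n.
Proof. exact/esym/gis_mul_pi. Qed.

Lemma pi_gis_rel (m n : gis_term E) :
  gis_rel m n -> \pi_(gis E) m = \pi_(gis E) n.
Proof. by move=> mn; apply/gis_piP/Cgen. Qed.

Lemma mul0g x : gzero * x = gzero.
Proof. by elim/quotW: x => m; rewrite -pi_mul; apply/pi_gis_rel/gis_mul0. Qed.

Lemma mulg0 x : x * gzero = gzero.
Proof. by elim/quotW: x => m; rewrite -pi_mul; apply/pi_gis_rel/gis_mulx0. Qed.

Lemma vertexK v : gvertex v * gvertex v = gvertex v.
Proof. by rewrite -pi_mul; apply/pi_gis_rel/gis_vv. Qed.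

Lemma vertexM0 v u : v <> u -> gvertex v * gvertex u = gzero.
Proof. by move=> vu; rewrite -pi_mul; apply/pi_gis_rel/gis_vu. Qed.

Lemma src_edge e : gvertex (src e) * gedge e = gedge e.
Proof. by rewrite -pi_mul; apply/pi_gis_rel/gis_se. Qed.

Lemma edge_rng e : gedge e * gvertex (rng e) = gedge e.
Proof. by rewrite -pi_mul; apply/pi_gis_rel/gis_er. Qed.

Lemma rng_inv e : gvertex (rng e) * ginv e = ginv e.
Proof. by rewrite -pi_mul; apply/pi_gis_rel/gis_rV. Qed.

Lemma inv_src e : ginv e * gvertex (src e) = ginv e.
Proof. by rewrite -pi_mul; apply/pi_gis_rel/gis_Vs. Qed.

Lemma inv_edge e : ginv e * gedge e = gvertex (rng e).
Proof. by rewrite -pi_mul; apply/pi_gis_rel/gis_Ve. Qed.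

Lemma inv_edge0 e f : e <> f -> ginv e * gedge f = gzero.
Proof. by move=> ef; rewrite -pi_mul; apply/pi_gis_rel/gis_Vf. Qed.

Fixpoint gpath p w : S :=
  if p is e :: p' then gedge e * gpath p' w else gvertex w.

Fixpoint gpathV p w : S :=
  if p is e :: p' then gpathV p' w * ginv e else gvertex w.

Lemma gpathl u p w : edge_path u p w -> gvertex u * gpath p w = gpath p w.
Proof.
by case: p => [/= ->|e p [<- _]] /=; [exact: vertexK | rewrite mulgA src_edge].
Qed.

Lemma gpathVr u p w : edge_path u p w -> gpathV p w * gvertex u = gpathV p w.
Proof.
by case: p => [/= ->|e p [<- _]] /=; [exact: vertexK | rewrite -mulgA inv_src].
Qed.

Lemma gpathr p w : gpath p w * gvertex w = gpath p w.
Proof. by elim: p => [|e p IHp] /=; [exact: vertexK | rewrite -mulgA IHp]. Qed.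

Lemma gpathVl p w : gvertex w * gpathV p w = gpathV p w.
Proof. by elim: p => [|e p IHp] /=; [exact: vertexK | rewrite mulgA IHp]. Qed.

Lemma gpath_cat w p q z :
  edge_path w q z -> gpath (p ++ q) z = gpath p w * gpath q z.
Proof.
by move=> wq; elim: p => [|e p IHp] /=; rewrite ?(gpathl wq) // IHp mulgA.
Qed.

Lemma gpathV_cat w p q z :
  edge_path w q z -> gpathV (p ++ q) z = gpathV q z * gpathV p w.
Proof.
by move=> wq; elim: p => [|e p IHp] /=; rewrite ?(gpathVr wq) // IHp mulgA.
Qed.

Lemma gpathVK u p w : edge_path u p w -> gpathV p w * gpath p w = gvertex w.
Proof.
elim: p u => [|e p IHp] u /=; first by move=> _; exact: vertexK.
case=> _ ep; rewrite mulgA -(mulgA _ (ginv e)) inv_edge (gpathVr ep).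
exact: IHp ep.
Qed.

(** Two paths cancel against each other exactly when one is a prefix of the
    other; this is what makes every product reducible. *)
Lemma gpathV_gpath u v q w r z : edge_path u q w -> edge_path v r z ->
  [\/ gpathV q w * gpath r z = gzero,
      exists r', [/\ r = q ++ r', edge_path w r' z
                   & gpathV q w * gpath r z = gpath r' z]
    | exists q', [/\ q = r ++ q', edge_path z q' w
                   & gpathV q w * gpath r z = gpathV q' w]].
Proof.
move=> uq vr; have [uv|uv] := pselect (u = v); last first.
  constructor 1; rewrite -(gpathVr uq) -(gpathl vr) mulgA.
  by rewrite -(mulgA _ (gvertex u)) vertexM0 // mulg0 mul0g.
elim: q r u v uq vr uv => [|e q IHq] r u v /=.
  move=> -> vr ->; constructor 2; exists r; split=> //.
  exact: gpathl vr.
case: r => [|f r] /=.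
  move=> [eu eq] vz uv; constructor 3; exists (e :: q); split=> //=.
    by split=> //; rewrite eu uv vz.
  by rewrite -vz -uv -eu -mulgA inv_src.
move=> [_ eq] [_ fr] _; rewrite mulgA -(mulgA _ (ginv e)).
have [ef|ef] := pselect (e = f); last first.
  by constructor 1; rewrite inv_edge0 // mulg0 mul0g.
rewrite -ef in fr *; rewrite inv_edge (gpathVr eq).
have [->|[r' [-> wr' ->]]|[q' [-> zq' ->]]] := IHq _ _ _ eq fr erefl.
- by constructor 1.
- by constructor 2; exists r'.
- by constructor 3; exists q'.
Qed.

(** The set of elements p q^-1, with zero, contains the generators and is closed
    under products, since the middle factors q^-1 r of p q^-1 r s^-1 cancel. *)
Lemma normal_formP x : x = gzero \/ exists u p v q w,
  [/\ edge_path u p w, edge_path v q w & x = gpath p w * gpathV q w].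
Proof.
elim/quotW: x; elim=> [|v|e|e|m [IHm|IHm] n [IHn|IHn]]; first by left.
- by right; exists v, [::], v, [::], v; split=> //=; rewrite vertexK.
- right; exists (src e), [:: e], (rng e), [::], (rng e); split=> //=.
  by rewrite edge_rng edge_rng.
- right; exists (rng e), [::], (src e), [:: e], (rng e); split=> //=.
  by rewrite !rng_inv.
- by left; rewrite pi_mul IHm mul0g.
- by left; rewrite pi_mul IHm mul0g.
- by left; rewrite pi_mul IHn mulg0.
move: IHm => [u [p [v [q [w [up vq mE]]]]]].
move: IHn => [u' [r [v' [s [z [ur vs nE]]]]]].
rewrite pi_mul mE nE mulgA -(mulgA (gpath p w)).
have [->|[r' [rE wr' ->]]|[q' [qE zq' ->]]] := gpathV_gpath vq ur.
- by left; rewrite mulg0 mul0g.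
- right; exists u, (p ++ r'), v', s, z; split=> //.
    exact: edge_path_cat up wr'.
  by rewrite (gpath_cat _ wr').
- right; exists u, p, v', (s ++ q'), w; split=> //.
    exact: edge_path_cat vs zq'.
  by rewrite (gpathV_cat _ zq') mulgA.
Qed.

(** * The action on paths with a given range *)

(** Once w is fixed, a path ending at w is given by its word of edges alone, the
    empty word being the trivial path at w. *)
Definition path_src w p := if p is e :: _ then src e else w.

(** G(E) acts by partial injections on the paths ending at w: a vertex fixes the
    paths starting at it, an edge is prepended and an inverse edge is removed.
    Elements given only by generators and relations are told apart by what they
    do to paths. *)
Fixpoint term_act w (m : gis_term E) p : option (seq (edge E)) :=
  match m with
  | GZero => None
  | GVertex v => if `[< path_src w p = v >] then Some p else None
  | GEdge e => if `[< path_src w p = rng e >] then Some (e :: p) else None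
  | GInv e => if p is f :: p' then
      if `[< f = e /\ path_src w p' = rng e >] then Some p' else None
    else None
  | GMul m n => obind (term_act w m) (term_act w n p)
  end.

Lemma term_act_rel w m n :
  cong_closure (@GMul E) (@gis_rel E) m n -> term_act w m =1 term_act w n.
Proof.
elim=> {m n} [? ? []|m|m n _ IH|m n o _ IH1 _ IH2|o m n _ IH|o m n _ IH] //=.
- by move=> m n o p; case: (term_act w o p).
- by move=> m p; case: (term_act w m p).
- by move=> v p; case: asboolP => //= vp; case: asboolP.
- move=> v u vu p; case: asboolP => //= up; case: asboolP => // vp.
  by case: vu; rewrite -vp.
- by move=> e p; case: asboolP => //= _; case: asboolP.
- by move=> e p; case: asboolP => //= ep; case: asboolP.
- move=> e [|f p] //=; case: asboolP => //= -[_ ep].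
  by case: asboolP.
- move=> e [|f p] /=; first by case: asboolP.
  have [->|fe] := pselect (f = e); first by rewrite asboolT //=.
  have nfe : ~ (f = e /\ path_src w p = rng e) by case.
  by rewrite (asboolF nfe); case: asboolP => //= _; rewrite (asboolF nfe).
- move=> e p; case: asboolP => //= ep; by rewrite asboolT.
- move=> e f ef p; case: asboolP => //= fp; case: asboolP => // -[fe].
  by case: ef.
- by move=> p; rewrite IH1 IH2.
- by move=> p /=; rewrite IH.
- by move=> p /=; case: (term_act w o p) => //= ?; rewrite IH.
Qed.

Definition act w x := term_act w (repr x).

Lemma act_pi w m p : act w (\pi_(gis E) m) p = term_act w m p.
Proof. by apply: term_act_rel; apply/gis_piP; rewrite reprK. Qed.

Lemma actM w x y p : act w (x * y) p = obind (act w x) (act w y p).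
Proof.
elim/quotW: x => m; elim/quotW: y => n; rewrite -pi_mul !act_pi /=.
by case: (term_act w n p) => //= q; rewrite act_pi.
Qed.

Lemma act_zero w p : act w gzero p = None.
Proof. by rewrite act_pi. Qed.

Lemma act_vertex w v p :
  act w (gvertex v) p = if `[< path_src w p = v >] then Some p else None.
Proof. by rewrite act_pi. Qed.

Lemma act_idem w e p : path_src w p = rng e ->
  act w (gedge e * ginv e) (e :: p) = Some (e :: p).
Proof. by move=> ep; rewrite -pi_mul act_pi /= asboolT //= asboolT. Qed.

Lemma act_idemP w e p q : act w (gedge e * ginv e) p = Some q ->
  exists2 p', p = e :: p' & path_src w p' = rng e.
Proof.
rewrite -pi_mul act_pi /=; case: p => // f p.
by case: asboolP => //= -[-> ep] _; exists p.
Qed.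

Definition ends_at w p := edge_path (path_src w p) p w.

Lemma edge_path_src u p w : edge_path u p w -> path_src w p = u.
Proof. by case: p => [->|e p []]. Qed.

Lemma edge_path_ends_at u p w : edge_path u p w -> ends_at w p.
Proof. by move=> up; rewrite /ends_at (edge_path_src up). Qed.

Lemma act_ends_at w x p q : act w x p = Some q -> ends_at w p -> ends_at w q.
Proof.
elim/quotW: x => m; rewrite act_pi.
elim: m p q => //= [v|e|e|m IHm n IHn] p q.
- by case: asboolP => // _ [<-].
- by case: asboolP => // ep [<-]; rewrite /ends_at /= -ep.
- case: p => // f p; case: asboolP => // -[-> ep] [<-].
  by rewrite /ends_at /= ep => -[].
- by case np: (term_act w n p) => [o|] //= om /(IHn _ _ np); exact: IHm om.
Qed.

(** Extending paths at their far end commutes with the action. *)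
Lemma act_cat z x w p q t : edge_path z t w ->
  act z x p = Some q -> act w x (p ++ t) = Some (q ++ t).
Proof.
move=> zt; have src_cat o : path_src w (o ++ t) = path_src z o.
  by case: o => //=; exact: edge_path_src zt.
elim/quotW: x => m; rewrite !act_pi.
elim: m p q => //= [v|e|e|m IHm n IHn] p q.
- by rewrite src_cat; case: asboolP => // _ [<-].
- by rewrite src_cat; case: asboolP => // ep [<-].
- by case: p => //= f p; rewrite src_cat; case: asboolP => // _ [<-].
- by case np: (term_act z n p) => [o|] //= /IHm; rewrite (IHn _ _ np).
Qed.

Lemma act_gpath u p w : edge_path u p w -> act w (gpath p w) [::] = Some p.
Proof.
elim: p u => [|e p IHp] u /=; first by rewrite act_vertex asboolT.
case=> _ ep; rewrite actM (IHp _ ep) /= act_pi /= asboolT //.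
exact: edge_path_src ep.
Qed.

Lemma act_gpathV u p w : edge_path u p w -> act w (gpathV p w) p = Some [::].
Proof.
elim: p u => [|e p IHp] u /=; first by rewrite act_vertex asboolT.
case=> _ ep; rewrite actM act_pi /= asboolT /=; first exact: IHp ep.
by rewrite (edge_path_src ep).
Qed.

Lemma nonzero_actP x :
  x <> gzero <-> exists w p q, ends_at w p /\ act w x p = Some q.
Proof.
split=> [x0|[w [p [q [_]]]]]; last by move=> + x0; rewrite x0 act_zero.
have [//|[u [p [v [q [w [up vq ->]]]]]]] := normal_formP x.
exists w, q, p; split; first exact: edge_path_ends_at vq.
by rewrite actM (act_gpathV vq) /= (act_gpath up).
Qed.

Lemma vertex_neq0 v : gvertex v <> gzero.
Proof.
apply/nonzero_actP; exists v, [::], [::]; split=> //.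
by rewrite act_vertex asboolT.
Qed.

Lemma vertex_neq_idem v e : gvertex v <> gedge e * ginv e.
Proof.
move/(congr1 (fun x => act v x [::])); rewrite act_vertex asboolT //.
by move/esym/act_idemP => -[].
Qed.

(** A product through u that fixes the trivial path at v has visited a path from
    u to v. *)
Lemma vertex_factor v u a b : gvertex v = a * gvertex u * b -> vge u v.
Proof.
move=> vE; have : act v (gvertex v) [::] = Some [::].
  by rewrite act_vertex asboolT.
rewrite vE !actM; case bp: (act v b [::]) => [p|] //=.
rewrite actM act_vertex; case: asboolP => // pu _; exists p.
by have := act_ends_at bp erefl; rewrite /ends_at pu.
Qed.

(** * Pairs forced into a congruence *)

Lemma congM0 rho a b x : rho x gzero -> rho (a * x * b) gzero.
Proof. by move=> /(congMl a)/(congMr b); rewrite mulg0 mul0g. Qed.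

Lemma cong_zero_vge rho v u :
  rho (gvertex v) gzero -> vge v u -> rho (gvertex u) gzero.
Proof.
move=> v0 [p vp]; rewrite -(gpathVK vp) -(gpathVr vp).
exact: congM0 v0.
Qed.

Lemma cong_normal_form0 rho u p v q w : edge_path u p w -> edge_path v q w ->
  rho (gpath p w * gpathV q w) gzero <-> rho (gvertex w) gzero.
Proof.
move=> up vq; split=> [|w0]; last first.
  by rewrite -(gpathr p); apply: congM0.
move/(congM0 (gpathV p w) (gpath q w)).
by rewrite mulgA (gpathVK up) -mulgA (gpathVK vq) vertexK.
Qed.

(** The idempotent e e^-1 fixes every product starting with e, so it is related
    to whatever vertex such a product is related to. *)
Lemma cong_edge_left rho w e y : ~ rho (gvertex w) gzero ->
  rho (gvertex w) (gedge e * y) ->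
  src e = w /\ rho (gvertex w) (gedge e * ginv e).
Proof.
move=> w0 wy; have ew : src e = w.
  apply: contrapT => ew; apply: w0; have := congMl (gvertex w) wy.
  by rewrite vertexK -src_edge !mulgA vertexM0 ?mul0g // => /esym.
split=> //; apply: congT (wy) _; have := congMl (gedge e * ginv e) wy.
rewrite -mulgA -ew inv_src -(mulgA (gedge e)) (mulgA (ginv e)) inv_edge.
by rewrite mulgA edge_rng => /congS.
Qed.

Lemma cong_edge_right rho w e y : ~ rho (gvertex w) gzero ->
  rho (gvertex w) (y * ginv e) ->
  src e = w /\ rho (gvertex w) (gedge e * ginv e).
Proof.
move=> w0 wy; have ew : src e = w.
  apply: contrapT => ew; apply: w0; have := congMr (gvertex w) wy.
  by rewrite vertexK -inv_src -!mulgA vertexM0 ?mulg0.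
split=> //; apply: congT (wy) _; have := congMr (gedge e * ginv e) wy.
rewrite mulgA -ew src_edge -(mulgA y) (mulgA (ginv e)) inv_edge.
by rewrite rng_inv => /congS.
Qed.

(** The other edges at v are orthogonal to e, so their ranges collapse. *)
Lemma cong_idem_other rho v e f : rho (gvertex v) (gedge e * ginv e) ->
  src f = v -> f <> e -> rho (gvertex (rng f)) gzero.
Proof.
move=> ve fv fe; have := congMr (gedge f) (congMl (ginv f) ve).
by rewrite -fv inv_src inv_edge !mulgA inv_edge0 // !mul0g.
Qed.

Lemma cong_idem_rng rho v e : rho (gvertex v) (gedge e * ginv e) ->
  rho (gvertex (rng e)) gzero -> rho (gvertex v) gzero.
Proof.
by move=> ve /(congM0 (gedge e) (ginv e)); rewrite edge_rng; apply: congT.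
Qed.

Lemma cong_zero_idem rho v e : src e = v ->
  rho (gvertex v) gzero -> rho (gvertex v) (gedge e * ginv e).
Proof.
move=> ev v0; apply: congT (v0) _; have := congMr (gedge e * ginv e) v0.
by rewrite mulgA -ev src_edge mul0g => /congS.
Qed.

Lemma cong_vertex_nontrivial rho v y : rho (gvertex v) y -> y <> gvertex v ->
  rho (gvertex v) gzero \/
  exists2 e, src e = v & rho (gvertex v) (gedge e * ginv e).
Proof.
move=> vy yv; have [|v0] := pselect (rho (gvertex v) gzero); first by left.
right; have [y0|[u [p [u' [q [w [up uq yE]]]]]]] := normal_formP y.
  by case: v0; rewrite -y0.
case: p up yE => [|e p] /= up yE; last first.
  rewrite yE -mulgA in vy; have [ev ve] := cong_edge_left v0 vy.
  by exists e.
case: q uq yE => [|e q] /= uq yE; last first.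
  rewrite yE mulgA in vy; have [ev ve] := cong_edge_right v0 vy.
  by exists e.
rewrite vertexK in yE; case: v0; have := congMl (gvertex v) vy.
by rewrite vertexK yE vertexM0 // => vw; apply: yv; rewrite yE vw.
Qed.

(** * Vertices satisfying the graph condition *)

Definition good_vertex v :=
  [\/ sink v,
      [/\ exists e, sole_edge v e, ~ in_cycle v
        & exists2 u, vgt v u & ~ exists e, sole_edge u e]
    | branching v /\ forall e, src e = v -> vge (rng e) v].

(** At a vertex with several edges that all lead back to it, one of the other
    edges has its range killed, hence the vertex itself. *)
Lemma good_vertex_idem rho v e : good_vertex v -> src e = v ->
  rho (gvertex v) (gedge e * ginv e) ->
  rho (gvertex v) gzero \/ sole_edge v e /\ ~ in_cycle v.
Proof.
move=> [v0|[[f [fv vf]] vc _]|[[f [g [fv gv fg]]] back]] ev ve.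
- by case: (v0 e).
- by right; split=> //; rewrite (vf e ev).
left; have [f' fv' fe] : exists2 f', src f' = v & f' <> e.
  have [fe|fe] := pselect (f = e); last by exists f.
  by exists g => // ge; apply: fg; rewrite fe ge.
by apply: (cong_zero_vge (cong_idem_other ve fv' fe)); apply: back.
Qed.

Lemma good_closed_path rho w t : good_vertex w -> edge_path w t w ->
  ~ rho (gvertex w) gzero -> rho (gvertex w) (gpath t w) -> t = [::].
Proof.
case: t => // e t gw wt w0 /= wy; have [ew we] := cong_edge_left w0 wy.
by have [//|[_ []]] := good_vertex_idem gw ew we;
apply: closed_path_in_cycle wt _.
Qed.

(** As w is idempotent, r s^-1 is related to its square; cancelling r on the
    left and s^-1 on the right relates z to s^-1 r, which is zero, a closed
    path at z or the inverse of one. Good vertices only leave the trivial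
    path. *)
Lemma good_normal_form rho w r s u v z : (forall v, good_vertex v) ->
  ~ rho (gvertex w) gzero -> edge_path u r z -> edge_path v s z ->
  rho (gvertex w) (gpath r z * gpathV s z) -> r = s.
Proof.
move=> good w0 ur vs wy; set y := gpath r z * gpathV s z in wy.
have z0 : ~ rho (gvertex z) gzero.
  by move=> /(cong_normal_form0 _ ur vs) y0; apply: w0; apply: congT wy y0.
have zy : rho (gvertex z) (gpathV s z * gpath r z).
  have : rho y (y * y).
    apply: congT (congS wy) _; rewrite -(vertexK w).
    exact: congT (congMr _ wy) (congMl _ wy).
  move=> /(congMl (gpathV r z))/(congMr (gpath s z)); rewrite /y !mulgA.
  rewrite (gpathVK ur) gpathVl (gpathVK vs) -mulgA.
  by rewrite -mulgA -(mulgA (gpath r z)) (gpathVK vs) gpathr.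
have [c0|[t [rE zt tE]]|[t [sE zt tE]]] := gpathV_gpath vs ur.
- by case: z0; rewrite -c0.
- by rewrite rE (good_closed_path (good z) zt z0) ?cats0 // -tE.
- rewrite sE (good_closed_path (good z) zt z0) ?cats0 //.
  rewrite tE in zy; have := congMr (gpath t z) zy.
  by rewrite (gpathVK zt) (gpathl zt) => /congS.
Qed.

(** Conjugating a relation between w and r r^-1 by the first edge of r gives the
    same kind of relation for the rest of r. *)
Lemma cong_idem_transfer rho sigma w r z :
  (forall v e, src e = v -> rho (gvertex v) (gedge e * ginv e) ->
     ~ rho (gvertex v) gzero -> sigma (gvertex v) (gedge e * ginv e)) ->
  edge_path w r z -> ~ rho (gvertex w) gzero ->
  rho (gvertex w) (gpath r z * gpathV r z) ->
  sigma (gvertex w) (gpath r z * gpathV r z).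
Proof.
move=> rs; elim: r w => [|e r IHr] w /=.
  by move=> -> _ _; rewrite vertexK; exact: congR.
move=> [ew er] w0 wy.
have [_ we] : src e = w /\ rho (gvertex w) (gedge e * ginv e).
  by rewrite -mulgA in wy; exact: cong_edge_left w0 wy.
apply: congT (rs _ _ ew we w0) _.
rewrite -{1}(edge_rng e) mulgA -(mulgA (gedge e) (gpath r z)).
apply/congMr/congMl/IHr => //; first by move/(cong_idem_rng we).
have := congMr (gedge e) (congMl (ginv e) wy).
rewrite -ew inv_src inv_edge !mulgA inv_edge -!mulgA inv_edge mulgA.
by rewrite (gpathVr er) (gpathl er).
Qed.

(** On a graph of good vertices a congruence is determined by the vertices it
    relates to zero and the edges e for which it relates src e to e e^-1: after
    cancelling the common outer factors, a related pair of normal forms becomes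
    a vertex w related to some r s^-1, where r = s, so that the relation splits
    into one step for each edge of r. *)
Theorem good_cong_le rho sigma : (forall v, good_vertex v) ->
  (forall v, rho (gvertex v) gzero -> sigma (gvertex v) gzero) ->
  (forall v e, src e = v -> rho (gvertex v) (gedge e * ginv e) ->
     ~ rho (gvertex v) gzero -> sigma (gvertex v) (gedge e * ginv e)) ->
  (rho <= sigma)%O.
Proof.
move=> good rs0 rs1; apply/cong_leP => x y xy.
have to0 a : rho a gzero -> sigma a gzero.
  have [-> _|[u [p [v [q [w [up vq ->]]]]]]] := normal_formP a.
    exact: congR.
  by rewrite !(cong_normal_form0 _ up vq); exact: rs0.
have [x0|x0] := pselect (rho x gzero).
  exact: congT (to0 _ x0) (congS (to0 _ (congT (congS xy) x0))).
have y0 : ~ rho y gzero by move=> y0; apply: x0; apply: congT xy y0.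
have [xz|[u [p [v [q [w [up vq xE]]]]]]] := normal_formP x.
  by case: x0; rewrite xz; exact: congR.
have [yz|[u' [r [v' [s [z [ur vs yE]]]]]]] := normal_formP y.
  by case: y0; rewrite yz; exact: congR.
wlog pr : x y xy x0 y0 u p v q w up vq xE u' r v' s z ur vs yE /
    (size p <= size r)%N => [th|].
  have [pr|/ltnW rp] := leqP (size p) (size r).
    exact: (th x y xy x0 y0 u p v q w up vq xE u' r v' s z ur vs yE pr).
  apply/congS.
  exact: (th y x (congS xy) y0 x0 u' r v' s z ur vs yE u p v q w up vq xE rp).
have w0 : ~ rho (gvertex w) gzero by rewrite -(cong_normal_form0 _ up vq) -xE.
have prod : rho (gvertex w) (gpathV p w * gpath r z * (gpathV s z * gpath q w)).
  have := congMr (gpath q w) (congMl (gpathV p w) xy).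
  by rewrite xE yE !mulgA (gpathVK up) gpathVl (gpathVK vq).
(* p and r are comparable since the product is not killed, and p is shorter. *)
have [r' rE wr'] : exists2 r', r = p ++ r' & edge_path w r' z.
  have [pr0|[r' [-> wr' _]]|[p' [pE zp' _]]] := gpathV_gpath up ur.
  - by case: w0; rewrite pr0 mul0g in prod.
  - by exists r'.
  have p'0 : p' = [::].
    apply/nilP; move: pr.
    by rewrite pE size_cat -{2}[size r]addn0 leq_add2l leqn0.
  by exists [::]; rewrite ?pE p'0 ?cats0 // in zp' *.
move: prod; rewrite rE (gpath_cat _ wr') (mulgA (gpathV p w)).
rewrite (gpathVK up) (gpathl wr').
have [->|[q' [qE zq' ->]]|[s' [sE ws' ->]]] := gpathV_gpath vs vq.
- by rewrite mulg0 => /w0.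
- rewrite -(gpath_cat _ zq').
  move=> /(good_closed_path (good w) (edge_path_cat wr' zq') w0)/nilP.
  rewrite cat_nilp => /andP[/nilP r'0 /nilP q'0].
  move: wr'; rewrite r'0 => /= wz.
  by rewrite xE yE rE qE r'0 q'0 !cats0 wz; exact: congR.
- move=> wy; have rs := good_normal_form good w0 wr' ws' wy.
  rewrite -rs in sE wy; have {wy}:= cong_idem_transfer rs1 wr' w0 wy.
  move=> /(congMl (gpath p w))/(congMr (gpathV q w)).
  by rewrite gpathr -xE yE rE sE (gpath_cat _ wr') (gpathV_cat _ wr') !mulgA.
Qed.

(** * Three families of congruences *)

Definition vertex_ideal v x := x = gzero \/ exists a b, x = a * gvertex v * b.

Fact rees_subproof v :
  is_congruence (fun x y => x = y \/ vertex_ideal v x /\ vertex_ideal v y).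
Proof.
have idMl x a : vertex_ideal v x -> vertex_ideal v (a * x).
  move=> [->|[b [c ->]]]; first by left; rewrite mulg0.
  by right; exists (a * b), c; rewrite !mulgA.
have idMr x a : vertex_ideal v x -> vertex_ideal v (x * a).
  move=> [->|[b [c ->]]]; first by left; rewrite mul0g.
  by right; exists b, (c * a); rewrite !mulgA.
split=> [x|x y [->|[]]|x y z [->|[xv yv]] // [<-|[_ zv]]|x y [->|[xv yv]] a].
- by left.
- by left.
- by right.
- by right.
- by right.
- by split; left.
- by split; right; split; [apply: idMl|apply: idMl|apply: idMr|apply: idMr].
Qed.

(** The Rees congruence of the ideal generated by v. *)
Definition rees v : congruence S := Congruence (rees_subproof v).

Lemma rees_zero v : rees v (gvertex v) gzero.
Proof.
right; split; last by left.
by right; exists (gvertex v), (gvertex v); rewrite !vertexK.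
Qed.

Lemma rees_le rho v : rho (gvertex v) gzero -> (rees v <= rho)%O.
Proof.
move=> v0; have id0 x : vertex_ideal v x -> rho x gzero.
  by move=> [->|[a [b ->]]]; [exact: congR | exact: congM0].
apply/cong_leP => x y [->|[/id0 x0 /id0 y0]]; first exact: congR.
exact: congT x0 (congS y0).
Qed.

Lemma rees_vge v u y : rees v (gvertex u) y -> gvertex u <> y -> vge v u.
Proof.
by move=> [//|[[/vertex_neq0//|[a [b uE]]] _]] _; exact: vertex_factor uE.
Qed.

Lemma rees_nontrivial v : nontrivial (rees v).
Proof.
exists (gvertex v), gzero; split; [exact: rees_zero | exact: vertex_neq0].
Qed.

Fact zero_context_subproof :
  is_congruence
    (fun x y => forall a b, a * x * b = gzero <-> a * y * b = gzero).
Proof.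
split=> [x a b|x y xy a b|x y z xy yz a b|x y xy c] //.
- by rewrite xy.
- by rewrite xy.
- by split=> a b; have := xy (a * c) b; have := xy a (c * b); rewrite !mulgA.
Qed.

(** The largest congruence whose class of zero is trivial; meeting with it
    removes the killed vertices from a congruence. *)
Definition zero_context : congruence S := Congruence zero_context_subproof.

Lemma zero_context_zero v : ~ zero_context (gvertex v) gzero.
Proof.
move=> /(_ (gvertex v) (gvertex v)) [_ h]; apply: (@vertex_neq0 v).
by move: h; rewrite mulg0 mul0g !vertexK; apply.
Qed.

Lemma act_sole_edge v e w p :
  sole_edge v e -> ends_at w p -> (p = [::] -> w <> v) ->
  act w (gvertex v) p = act w (gedge e * ginv e) p.
Proof.
case: p => [|f p] [ev ve] wp wv; rewrite act_vertex /=.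
  rewrite asboolF; last exact: wv.
  by case ep: (act _ _ _) => //; have [] := act_idemP ep.
case: asboolP => [/ve fe|fv].
  rewrite fe act_idem //; move: wp; rewrite /ends_at /= fe => -[_].
  exact: edge_path_src.
case ep: (act _ _ _) => //; have [p' [fe _] _] := act_idemP ep.
by case: fv; rewrite fe.
Qed.

(** The idempotent e e^-1 acts as v except on the trivial path at v. A product
    a v b that is not zero acts on some path, and prolonging that path by e
    avoids the exception. *)
Lemma zero_context_sole_edge v e :
  sole_edge v e -> zero_context (gvertex v) (gedge e * ginv e).
Proof.
move=> ve a b.
have actE w p p' : ends_at w p -> act w b p = Some p' -> p' <> [::] ->
    act w (a * gvertex v * b) p = act w (a * (gedge e * ginv e) * b) p.
  move=> wp bp p'0; rewrite 2!(actM _ (a * _)) bp /= 2!(actM _ a).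
  by rewrite (act_sole_edge ve (act_ends_at bp wp)) // => /p'0.
split; apply: contraPP => /nonzero_actP [w [p [q [wp abp]]]];
  apply/nonzero_actP.
  exists w, p, q; split=> //; move: (abp); rewrite actM.
  case bp: (act w b p) => [[|f p']|] //=; last by rewrite (actE _ _ _ wp bp).
  by rewrite actM; case ep: (act w _ _) => //; have [] := act_idemP ep.
move: (abp); rewrite actM; case bp: (act w b p) => [[|f p']|] //=; last first.
  by move=> _; exists w, p, q; split=> //; rewrite -(actE _ _ _ wp bp).
rewrite actM act_vertex; case: asboolP => //= wv _.
have wr : edge_path w [:: e] (rng e).
  by split=> //; rewrite wv; case: ve.
have wpe : ends_at (rng e) (p ++ [:: e]).
  exact: edge_path_ends_at (edge_path_cat wp wr).
exists (rng e), (p ++ [:: e]), (q ++ [:: e]); split=> //.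
by rewrite -(actE _ _ _ wpe (act_cat wr bp)) //; apply: act_cat abp.
Qed.

Fact kernel_away_subproof v : is_congruence (fun x y =>
  forall w p, w <> v -> ends_at w p -> act w x p = act w y p).
Proof.
split=> [x w p|x y xy w p wv wp|x y z xy yz w p wv wp|x y xy a] //.
- by rewrite xy.
- by rewrite xy // yz.
- split=> w p wv wp; rewrite !actM; first by rewrite xy.
  case ap: (act w a p) => [q|] //=; apply: xy => //.
  exact: act_ends_at ap wp.
Qed.

(** When all vertices are good and v has a sole edge e, this is the congruence
    generated by (v, e e^-1). Being a kernel, it comes with a test for the pairs
    that do not belong to it. *)
Definition kernel_away v : congruence S := Congruence (kernel_away_subproof v).

Lemma kernel_away_idem v e : sole_edge v e ->
  kernel_away v (gvertex v) (gedge e * ginv e).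
Proof.
by move=> ve w p wv wp; apply: act_sole_edge.
Qed.

Lemma kernel_away_idem_eq v u f :
  kernel_away v (gvertex u) (gedge f * ginv f) -> u = v.
Proof.
move=> k; apply: contrapT => uv; have := k u [::] uv erefl.
by rewrite act_vertex asboolT // => /esym/act_idemP[].
Qed.

(** The trivial path at u separates u from zero, unless u = v; then the path e
    does. *)
Lemma kernel_away_zero v e u : src e = v -> rng e <> v ->
  ~ kernel_away v (gvertex u) gzero.
Proof.
move=> ev rv k; have [uv|uv] := pselect (u = v).
  have := k (rng e) [:: e] rv (conj erefl erefl).
  by rewrite act_vertex act_zero asboolT //= ev uv.
by have := k u [::] uv erefl; rewrite act_vertex act_zero asboolT.
Qed.

(** * Necessity of the condition *)

Lemma atom_zero_le alpha v :
  atom alpha -> alpha (gvertex v) gzero -> (alpha <= rees v)%O.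
Proof.
by move=> /atomP[_ min] v0; apply: min (rees_le v0) (rees_nontrivial v).
Qed.

(** An atom that kills v is the Rees congruence of each vertex u below v, and a
    Rees congruence only kills what lies below its vertex. *)
Lemma atom_zero_vge alpha v u :
  atom alpha -> alpha (gvertex v) gzero -> vge v u -> vge u v.
Proof.
move=> aa v0 /(cong_zero_vge v0) /(atom_zero_le aa) /cong_leP/(_ _ _ v0).
move/rees_vge; apply; exact: vertex_neq0.
Qed.

(** Below a congruence that kills v lies one that relates v to e e^-1 without
    killing anything; so the former is not minimal. *)
Lemma atom_zero_sole_edge alpha v e :
  atom alpha -> alpha (gvertex v) gzero -> ~ sole_edge v e.
Proof.
move=> /atomP[_ min] v0 ve; pose c := cong_meet alpha zero_context.
have /cong_leP ac : (alpha <= c)%O.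
  apply: min; first by apply/cong_leP => x y [].
  exists (gvertex v), (gedge e * ginv e); split; last exact: vertex_neq_idem.
  split; last exact: zero_context_sole_edge.
  by apply: cong_zero_idem v0; case: ve.
by have [_ /zero_context_zero] := ac _ _ v0.
Qed.

Definition joins_of_atoms := forall rho,
  exists2 A : set (congruence S), A `<=` [set a | atom a] & supremums A rho.

Lemma joins_atom_class rho x y : joins_of_atoms -> rho x y -> y <> x ->
  exists alpha, [/\ atom alpha, (alpha <= rho)%O
                  & exists2 y', alpha x y' & y' <> x].
Proof.
move=> joins xy yx; have [A atomA supA] := joins rho.
have [alpha Aa xy'] := sup_class_nontrivial supA xy yx.
by exists alpha; split=> //; [exact: atomA | case: supA => ub _; exact: ub].
Qed.

(** Some atom below the Rees congruence of v moves zero, hence kills a vertex,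
    and this vertex lies below v. *)
Lemma joins_vge_atom v : joins_of_atoms ->
  exists u alpha, [/\ vge v u, atom alpha & alpha (gvertex u) gzero].
Proof.
move=> joins; have vne := @vertex_neq0 v.
have [alpha [aa av [y zy y0]]] :=
  joins_atom_class joins (congS (rees_zero v)) vne.
have [//|[u [p [u' [q [w [up uq yE]]]]]]] := normal_formP y.
have w0 : alpha (gvertex w) gzero.
  by apply/(cong_normal_form0 _ up uq); rewrite -yE; exact: congS.
exists w, alpha; split=> //.
exact: rees_vge (elimT (cong_leP _ _) av _ _ w0) (@vertex_neq0 w).
Qed.

(** Some atom below the Rees congruence of v moves v. If it relates v to g g^-1,
    it kills the range of another edge f, hence is the Rees congruence of that
    range, and so kills v as well. *)
Lemma joins_branching v e :
  joins_of_atoms -> branching v -> src e = v -> vge (rng e) v.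
Proof.
move=> joins [f1 [f2 [f1v f2v f12]]] ev.
have [alpha [aa av [y vy yv]]] :=
  joins_atom_class joins (rees_zero v) (nesym (@vertex_neq0 v)).
have [v0|[g gv vg]] := cong_vertex_nontrivial vy yv.
  by apply: atom_zero_vge aa v0 _; rewrite -ev; exact: vge_edge.
have [f fv fg] : exists2 f, src f = v & f <> g.
  have [f1g|f1g] := pselect (f1 = g); last by exists f1.
  by exists f2 => // f2g; apply: f12; rewrite f1g f2g.
have f0 := cong_idem_other vg fv fg.
have fgev : vge (rng f) v.
  apply: rees_vge (elimT (cong_leP _ _) (atom_zero_le aa f0) _ _ vg) _.
  exact: vertex_neq_idem.
apply: atom_zero_vge aa (cong_zero_vge f0 fgev) _.
by rewrite -ev; exact: vge_edge.
Qed.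

(** Descending from v one reaches a vertex u killed by an atom. It has no sole
    edge, and were v on a cycle, u would lead back to v, so that the atom would
    also kill v. *)
Lemma joins_good_vertex v : joins_of_atoms -> good_vertex v.
Proof.
move=> joins; have [?|[e ve]|vbr] := degree_cases v.
- by constructor 1.
- constructor 2; have [u [alpha [[p vu] aa u0]]] := joins_vge_atom v joins.
  have usole f : ~ sole_edge u f := atom_zero_sole_edge aa u0.
  split; first by exists e.
    move=> /in_cycle_closed_path[f fv fgev].
    have back q w (x : vertex E) : vge w v -> edge_path w q x -> vge x v.
      elim: q w => [|g q IHq] w wv /=; first by move=> <-.
      move=> [gw gx]; apply: IHq gx; have [w0|[h [_ wh]]|wbr] := degree_cases w.
      - by case: (w0 g).
      - case: wv => -[|k q'] /= => [wv|[kw kv]].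
          by rewrite (wh g gw) -(wh f) // fv wv.
        by exists q'; rewrite (wh g gw) -(wh k kw).
      - by apply: vge_trans (joins_branching joins wbr gw) wv.
    have uv := back p v u (vge_refl v) vu.
    by apply: (atom_zero_sole_edge aa (cong_zero_vge u0 uv) ve).
  exists u; last by move=> [f /usole].
  by split; [exists p | move=> vu'; apply: (usole e); rewrite -vu'].
- by constructor 3; split=> // e; exact: joins_branching.
Qed.

(** * Sufficiency of the condition *)

Definition canonical_atom v : congruence S :=
  if `[< exists e, sole_edge v e >] then kernel_away v else rees v.

Lemma canonical_atom_sole v e :
  sole_edge v e -> canonical_atom v = kernel_away v.
Proof. by move=> ve; rewrite /canonical_atom asboolT //; exists e. Qed.

Lemma canonical_atom_not_sole v :
  ~ (exists e, sole_edge v e) -> canonical_atom v = rees v.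
Proof. by move=> nve; rewrite /canonical_atom asboolF. Qed.

Definition moves rho v := exists2 y, rho (gvertex v) y & y <> gvertex v.

Lemma moves_zero rho v : rho (gvertex v) gzero -> moves rho v.
Proof. by exists gzero => // /esym/vertex_neq0. Qed.

Lemma moves_idem rho v e : rho (gvertex v) (gedge e * ginv e) -> moves rho v.
Proof. by exists (gedge e * ginv e) => // /esym/vertex_neq_idem. Qed.

Lemma moves_nontrivial rho v : moves rho v -> nontrivial rho.
Proof. by move=> [y vy yv]; exists (gvertex v), y; split=> // /esym. Qed.

Lemma canonical_atom_moves v : moves (canonical_atom v) v.
Proof.
have [[e ve]|nve] := pselect (exists e, sole_edge v e).
  rewrite (canonical_atom_sole ve).
  exact: moves_idem (kernel_away_idem ve).
by rewrite canonical_atom_not_sole //; apply/moves_zero/rees_zero.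
Qed.

Lemma good_sole_edge v e : good_vertex v -> sole_edge v e -> ~ in_cycle v.
Proof.
move=> [v0|[]//|[[f [g [fv gv fg]]] _]] [ev ve]; first by case: (v0 e).
by case: fg; rewrite (ve f fv) (ve g gv).
Qed.

Lemma good_sole_edge_rng v e : good_vertex v -> sole_edge v e -> rng e <> v.
Proof.
move=> gv ve rv; apply: good_sole_edge gv (ve) _.
by apply: (@closed_path_in_cycle v [:: e]) => //=; case: ve.
Qed.

(** An edge at a branching vertex has a range leading back to its source; this
    range then lies on a cycle, so it cannot have a sole edge. *)
Lemma good_vge_back v u : (forall w, good_vertex w) ->
  ~ (exists e, sole_edge v e) -> vge v u ->
  vge u v /\ ~ exists e, sole_edge u e.
Proof.
move=> good + [p]; elim: p v => [|e p IHp] v nve /=.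
  by move<-; split=> //; exact: vge_refl.
move=> [ev eu]; have [v0|[]//|[_ back]] := good v; first by case: (v0 e).
have [q rv] := back e ev.
have [|ur nu] := IHp (rng e) _ eu; last first.
  by split=> //; apply: vge_trans ur (back e ev).
move=> [f rf]; apply: good_sole_edge (good _) rf _.
apply: (@closed_path_in_cycle _ (q ++ [:: e])); last by case: (q).
by apply: edge_path_cat rv _.
Qed.

Lemma good_kernel_away_zero v e u : good_vertex v -> sole_edge v e ->
  ~ kernel_away v (gvertex u) gzero.
Proof.
move=> gv ve; apply: (@kernel_away_zero _ e); first by case: ve.
exact: good_sole_edge_rng gv ve.
Qed.

(** The attached atom is the least congruence that moves v. *)
Lemma canonical_atom_le rho v : (forall w, good_vertex w) -> moves rho v ->
  (canonical_atom v <= rho)%O.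
Proof.
move=> good [y vy yv]; have := cong_vertex_nontrivial vy yv.
have [[e ve]|nve] := pselect (exists e, sole_edge v e); last first.
  rewrite canonical_atom_not_sole // => -[|[e ev videm]]; first exact: rees_le.
  have [v0|[ve _]] := good_vertex_idem (good v) ev videm; first exact: rees_le.
  by case: nve; exists e.
rewrite (canonical_atom_sole ve) => h.
have {h} videm : rho (gvertex v) (gedge e * ginv e).
  case: h => [|[f fv]]; first by apply: cong_zero_idem; case: ve.
  by case: ve => _ /(_ f fv) ->.
apply: good_cong_le => // [u /(good_kernel_away_zero (good v) ve)//|u f fu k _].
move: k fu => /[dup] /kernel_away_idem_eq -> _ fv.
by case: ve => _ /(_ f fv) ->.
Qed.

Lemma good_nontrivial_moves rho : (forall w, good_vertex w) ->
  nontrivial rho -> exists v, moves rho v.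
Proof.
move=> good [x [y [xy nxy]]]; apply: contrapT => nmoves; apply: nxy.
have /cong_leP/(_ x y xy) // : (rho <= cong_diag S)%O.
apply: good_cong_le => // [v v0|v e _ ve _]; case: nmoves; exists v.
  exact: moves_zero.
exact: moves_idem ve.
Qed.

Lemma canonical_atom_moves_back rho v u : (forall w, good_vertex w) ->
  (rho <= canonical_atom v)%O -> moves rho u -> moves rho v.
Proof.
move=> good /cong_leP rv [y uy yu].
have [[e ve]|nve] := pselect (exists e, sole_edge v e).
  rewrite (canonical_atom_sole ve) in rv.
  have [u0|[f fu /kernel_away_idem_eq uv]] :=
    cong_vertex_nontrivial (rv _ _ uy) yu; last by exists y; rewrite -uv.
  by case: (good_kernel_away_zero (good v) ve u0).
rewrite canonical_atom_not_sole // in rv.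
have [uv nu] := good_vge_back good nve (rees_vge (rv _ _ uy) (nesym yu)).
have [u0|[e eu uidem]] := cong_vertex_nontrivial uy yu.
  exact/moves_zero/(cong_zero_vge u0).
have [u0|[ue _]] := good_vertex_idem (good u) eu uidem.
  exact/moves_zero/(cong_zero_vge u0).
by case: nu; exists e.
Qed.

Lemma canonical_atomP v : (forall w, good_vertex w) -> atom (canonical_atom v).
Proof.
move=> good; apply/atomP; split.
  exact: moves_nontrivial (canonical_atom_moves v).
move=> c cv /(good_nontrivial_moves good)[u cu].
exact/canonical_atom_le/(canonical_atom_moves_back good cv cu).
Qed.

(** A vertex v killed by rho is killed by the join of the atoms below rho: the
    atoms of the vertices with a sole edge push v down its unique path to a
    vertex u with several edges or none, whose atom is a Rees congruence. *)
Lemma canonical_atoms_supremum rho : (forall w, good_vertex w) ->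
  supremums
    [set alpha | (exists v, alpha = canonical_atom v) /\ (alpha <= rho)%O] rho.
Proof.
move=> good; split=> [alpha []//|sigma ub].
have atom_le v : moves rho v -> (canonical_atom v <= sigma)%O.
  by move=> rv; apply: ub; split; [exists v | exact: canonical_atom_le].
have idem v e : sole_edge v e -> moves rho v ->
    sigma (gvertex v) (gedge e * ginv e).
  move=> ve /atom_le; rewrite (canonical_atom_sole ve) => /cong_leP; apply.
  exact: kernel_away_idem.
have not_sole v : ~ (exists e, sole_edge v e) -> rho (gvertex v) gzero ->
    sigma (gvertex v) gzero.
  move=> nve /moves_zero/atom_le; rewrite canonical_atom_not_sole //.
  by move/cong_leP; apply; exact: rees_zero.
apply: good_cong_le => // [v v0|v e ev videm v0]; last first.
  apply: idem (moves_idem videm).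
  by have [|[]] := good_vertex_idem (good v) ev videm.
have [[e ve]|nve] := pselect (exists e, sole_edge v e); last exact: not_sole.
have [u [p vu] nu] : exists2 u, vge v u & ~ exists e, sole_edge u e.
  have [w0|[_ _ [u [vu _] nu]]|[[f [g [fv gv fg]]] _]] := good v.
  - by case: ve => /w0.
  - by exists u.
  - by case: ve => _ ve; case: fg; rewrite (ve f fv) (ve g gv).
elim: p v v0 vu {e ve} => [|e p IHp] v v0 /=.
  by move=> vu; rewrite vu in v0 *; exact: not_sole.
move=> [ev eu].
have [[f ve]|nve] := pselect (exists e, sole_edge v e); last exact: not_sole.
have fe : f = e by case: ve => _ /(_ e ev).
rewrite fe in ve; apply: cong_idem_rng (idem _ _ ve (moves_zero v0)) _.
by apply: IHp eu; apply: cong_zero_vge v0 _; rewrite -ev; exact: vge_edge.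
Qed.

Lemma joins_of_atomsP : joins_of_atoms <-> forall v, good_vertex v.
Proof.
split=> [joins v|good rho]; first exact: joins_good_vertex.
eexists; last exact: canonical_atoms_supremum.
by move=> alpha [[v ->] _]; exact: canonical_atomP.
Qed.

(** * Finite joins *)

Definition component v : set (vertex E) := [set u | vge v u /\ vge u v].

Lemma component_strong v : strong_component (component v).
Proof.
split=> [|u w [_ uv] [vw _]|K Kreach vK].
- by exists v; split; exact: vge_refl.
- exact: vge_trans uv vw.
apply/seteqP; split=> // u Ku.
have Kv : K v by apply: vK; split; exact: vge_refl.
by split; exact: Kreach.
Qed.

Lemma strong_componentP H : strong_component H -> exists v, H = component v.
Proof.
move=> [[v Hv] Hreach Hmax]; exists v; apply/esym/Hmax.
  by case: (component_strong v).
by move=> u Hu; split; exact: Hreach.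
Qed.

Lemma component_eq v u : vge v u -> vge u v -> component v = component u.
Proof.
move=> vu uv; apply/seteqP; split=> w [a b]; split.
- exact: vge_trans uv a.
- exact: vge_trans b vu.
- exact: vge_trans vu a.
- exact: vge_trans b uv.
Qed.

Lemma rees_eq v u : vge v u -> vge u v -> rees v = rees u.
Proof.
move=> vu uv; apply/le_anti/andP; split.
  exact/rees_le/(cong_zero_vge (rees_zero u)).
exact/rees_le/(cong_zero_vge (rees_zero v)).
Qed.

Lemma canonical_atom_sole_inj v u e :
  sole_edge v e -> canonical_atom v = canonical_atom u ->
  (exists f, sole_edge u f) -> v = u.
Proof.
move=> ve vu [f uf]; apply: (@kernel_away_idem_eq u v e).
rewrite -(canonical_atom_sole uf) -vu (canonical_atom_sole ve).
exact: kernel_away_idem.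
Qed.

Lemma canonical_atom_vge v u : (forall w, good_vertex w) ->
  canonical_atom v = canonical_atom u -> vge v u.
Proof.
move=> good vu; have [[e ve]|nve] := pselect (exists e, sole_edge v e).
  have [uf|nuf] := pselect (exists f, sole_edge u f).
    by rewrite (canonical_atom_sole_inj ve vu uf); exact: vge_refl.
  have /(good_kernel_away_zero (good v) ve) // :
    kernel_away v (gvertex u) gzero.
  rewrite -(canonical_atom_sole ve) vu canonical_atom_not_sole //.
  exact: rees_zero.
have [y uy yu] := canonical_atom_moves u.
move: uy; rewrite -vu canonical_atom_not_sole // => /rees_vge; apply.
exact: nesym.
Qed.

Lemma canonical_atom_component v u : (forall w, good_vertex w) ->
  canonical_atom v = canonical_atom u -> component v = component u.
Proof.
by move=> good vu; apply: component_eq; apply: canonical_atom_vge.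
Qed.

(** The atom of v depends only on its component unless v has a sole edge. *)
Lemma finite_canonical_atoms :
  finite_set [set H : set (vertex E) | strong_component H] ->
  finite_set [set v | exists e, sole_edge v e] ->
  finite_set (range canonical_atom).
Proof.
move=> fcomp fsole.
pose pick_rees (H : set (vertex E)) : congruence S :=
  xget (cong_diag S) [set alpha | exists2 v, H v & alpha = rees v].
have pick_reesE v : pick_rees (component v) = rees v.
  rewrite /pick_rees; case: xgetP => [alpha _ [u [vu uv] ->]|/(_ (rees v))[]].
    exact: rees_eq.
  by exists v => //; split; exact: vge_refl.
have fU : finite_set (pick_rees @` [set H | strong_component H] `|`
    canonical_atom @` [set v | exists e, sole_edge v e]).
  by rewrite finite_setU; split; exact: finite_image.
apply: sub_finite_set fU => alpha [v _ <-].
have [ve|nve] := pselect (exists e, sole_edge v e); first by right; exists v.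
left; exists (component v); first exact: component_strong.
by rewrite pick_reesE canonical_atom_not_sole.
Qed.

Fact universal_subproof : is_congruence (fun _ _ : S => True).
Proof. by split. Qed.

Lemma atomisticP : atomistic (congruence S) <->
  [/\ forall v, good_vertex v,
      finite_set [set H : set (vertex E) | strong_component H]
    & finite_set [set v | exists e, sole_edge v e]].
Proof.
have seq_sup (s : seq (congruence S)) :
    supremums [set` s] (\join_(alpha <- s) alpha)%O.
  split=> [alpha salpha|sigma ub]; first exact: joins_sup_seq.
  by apply/joinsP_seq => alpha salpha _; exact: ub.
split=> [atomic|[good fcomp fsole]]; last first.
  move=> rho; pose A := [set alpha | (exists v, alpha = canonical_atom v) /\
    (alpha <= rho)%O].
  have /finite_seqP[s sA] : finite_set A.
    apply: sub_finite_set (finite_canonical_atoms fcomp fsole).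
    by move=> alpha [[v ->] _]; exists v.
  exists s => [alpha salpha|].
    have [[v ->] _] : A alpha by rewrite sA.
    exact: canonical_atomP.
  have [ub lub] := canonical_atoms_supremum rho good.
  have [ub' lub'] := seq_sup s.
  rewrite -/A sA in ub lub.
  by apply/le_anti/andP; split; [exact: lub | exact: lub'].
have good : forall v, good_vertex v.
  apply/joins_of_atomsP => rho; have [s satom rhoE] := atomic rho.
  exists [set` s]; first exact: satom.
  by rewrite rhoE; exact: seq_sup.
have [s satom topE] := atomic (Congruence universal_subproof).
(* The universal congruence moves v, so an atom in s does, and that atom can
   only be the one attached to v. *)
have fin : finite_set (range canonical_atom).
  apply: sub_finite_set (finite_seq s) => alpha [v _ <-] /=.
  have [] := @sup_class_nontrivial _ _ _ (gvertex v) gzero (seq_sup s) _ _.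
  - by rewrite -topE.
  - exact/nesym/vertex_neq0.
  move=> alpha' sa [y vy yv].
  suff -> : canonical_atom v = alpha' by [].
  have le : (canonical_atom v <= alpha')%O.
    by apply: canonical_atom_le => //; exists y.
  apply/le_anti; rewrite le /=.
  have /atomP[_] := satom _ sa; apply=> //.
  exact: moves_nontrivial (canonical_atom_moves v).
split=> //.
  pose comp alpha :=
    [set u | exists2 v, alpha = canonical_atom v & component v u].
  apply: sub_finite_set (finite_image comp fin) => _ /strong_componentP[v ->].
  exists (canonical_atom v); first by exists v.
  apply/seteqP; split=> [u [w vw]|u vu]; last by exists v.
  by rewrite (canonical_atom_component good vw).
have inj : {in [set v | exists e, sole_edge v e] &, injective canonical_atom}.
  move=> v u; rewrite !inE => -[e ve] uf vu.
  exact: canonical_atom_sole_inj ve vu uf.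
rewrite -(eq_finite_set (inj_card_eq inj)).
by apply: sub_finite_set fin => alpha [v _ <-]; exists v.
Qed.

End GraphInverseSemigroupCongruences.

Theorem theorem2p5 (E : digraph) :
  let vertex_condition (v : vertex E) : Prop :=
    [\/ out_edges v #= `I_0,
        [/\ out_edges v #= `I_1, ~ in_cycle v
          & exists2 u : vertex E, vgt v u & ~ (out_edges u #= `I_1)]
      | `I_2 #<= out_edges v
        /\ (forall e : edge E, out_edges v e -> vge (rng e) v)] in
  ((forall rho : congruence (gis E),
      exists2 A : set (congruence (gis E)),
        A `<=` [set a | atom a] & supremums A rho)
    <-> (forall v : vertex E, vertex_condition v))
  /\
  (atomistic (congruence (gis E))
    <-> [/\ forall v : vertex E, vertex_condition v,
            finite_set [set H : set (vertex E) | strong_component H]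
          & finite_set [set v : vertex E | out_edges v #= `I_1]]).
Proof.
move=> vertex_condition.
have condE v : vertex_condition v <-> good_vertex v.
  rewrite /vertex_condition (propext (out_edges_card0 v)).
  rewrite (propext (out_edges_card1 v)) (propext (out_edges_card2 v)).
  have -> : (fun u : vertex E => ~ (out_edges u #= `I_1)) =
            (fun u => ~ exists e, sole_edge u e).
    by apply/funext => u; rewrite (propext (out_edges_card1 u)).
  by [].
have allE : (forall v, vertex_condition v) <->
            (forall v : vertex E, good_vertex v).
  by split=> h v; apply/condE.
have soleE : [set v : vertex E | out_edges v #= `I_1] =
             [set v : vertex E | exists e, sole_edge v e].
  by apply/seteqP; split=> v /out_edges_card1.
rewrite (propext allE) soleE.
by split; [exact: joins_of_atomsP | exact: atomisticP].
Qed.
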